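(* Let $\mathcal{E}\subset[0,1]$ be the bifurcation set of the Tanaka-Ito family $(T_\alpha)_{\alpha\in[0,1]}$. Then $\mathcal{E}$ contains infinitely many rational numbers, and the set $\mathcal{E}\cap\mathbb{Q}$ has no isolated points. Moreover, for all $r\in\mathcal{E}\cap\mathbb{Q}$ and all $\delta>0$, \[ \dim_H\big(\mathcal{E}\cap(r-\delta,r+\delta)\big)>\tfrac12 . \]
   Context: $\dim_H$ denotes Hausdorff dimension. For $\alpha\in[0,1]$ the Tanaka-Ito map $T_\alpha:[\alpha-1,\alpha]\to[\alpha-1,\alpha]$ is defined by $T_\alpha(0)=0$ and $T_\alpha(x)=\frac1x-\left\lfloor\frac1x+1-\alpha\right\rfloor$ for $x\ne0$; $T_\alpha^n$ is its $n$-th iterate, $T_\alpha^0$ the identity. A non-empty open interval $J\subset[0,1]$ is a matching interval with matching exponents $M,N$ (positive integers) if $T_\alpha^M(\alpha-1)=T_\alpha^N(\alpha)$ for all $\alpha\in J$, $T_\alpha^{M-1}(\alpha-1)\ne T_\alpha^{N-1}(\alpha)$ for Lebesgue-almost all $\alpha\in J$, and $J$ is not contained in a larger open interval with these properties (for the same $M,N$). The matching set is the union of all matching intervals, and the bifurcation set $\mathcal{E}$ is the complement of the matching set in $[0,1]$. *)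

(* Defs.v *)
From HB Require Import structures.
From mathcomp Require Import all_boot all_order all_algebra.
From mathcomp Require Import all_classical all_reals all_analysis.
From mathcomp Require Import lra.

Set Implicit Arguments.
Unset Strict Implicit.
Unset Printing Implicit Defensive.

Import Order.TTheory GRing.Theory Num.Theory.
Import numFieldNormedType.Exports.

Local Open Scope classical_set_scope.
Local Open Scope ring_scope.

Section hausdorff_dimension.
Context {R : realType}.
Local Open Scope ereal_scope.

(* The added 0 only matters for the empty set, whose diameter is then 0
   instead of the supremum -oo of an empty set. *)
Definition diameter (A : set R) : \bar R :=
  ereal_sup (0%R%:E |` [set `|p.1 - p.2|%R%:E | p in A `*` A]).

(* Empty members of a cover contribute 0 to the sum; this matters only for
   s = 0, where 0 `^ 0 = 1. *)
Definition hausdorff_premeasure (s delta : R) (A : set R) : \bar R :=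
  ereal_inf [set \sum_(0 <= k <oo | U k != set0) diameter (U k) `^ s |
             U in [set U : (set R)^nat | A `<=` \bigcup_k U k /\
                                         forall k, diameter (U k) <= delta%:E]].

Definition hausdorff_measure (s : R) (A : set R) : \bar R :=
  ereal_sup [set hausdorff_premeasure s delta A |
             delta in [set delta : R | (0 < delta)%R]].

Definition hausdorff_dim (A : set R) : \bar R :=
  ereal_inf [set s%:E | s in [set s : R | (0 <= s)%R /\
                                          hausdorff_measure s A = 0]].

End hausdorff_dimension.

Section tanaka_ito.
Context {R : realType}.
Implicit Types (alpha x : R) (J : set R) (M N : nat).

(* A total function on R; the map of the Tanaka-Ito family is its restriction
   to [alpha - 1, alpha], which it preserves by tanaka_ito_itv. *)
Definition tanaka_ito alpha x : R :=
  if x == 0 then 0 else x^-1 - (Num.floor (x^-1 + 1 - alpha))%:~R.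

Lemma tanaka_ito_itv alpha x : alpha \in `[0, 1] ->
  tanaka_ito alpha x \in `[alpha - 1, alpha].
Proof.
rewrite !in_itv/= /tanaka_ito => /andP[a0 a1].
case: ifPn => _; first by rewrite subr_le0 a1 a0.
have /andP[] := floor_itv (x^-1 + 1 - alpha).
rewrite intrD; set f := (_%:~R); move=> h1 h2.
by apply/andP; split; lra.
Qed.

Definition open_subinterval J :=
  [/\ J !=set0, open J, is_interval J & J `<=` `[0, 1]].

Definition matching_on M N J :=
  (forall alpha, J alpha ->
     iter M (tanaka_ito alpha) (alpha - 1) = iter N (tanaka_ito alpha) alpha) /\
  (\forall alpha \ae (@lebesgue_measure R), J alpha ->
     iter M.-1 (tanaka_ito alpha) (alpha - 1) <>
     iter N.-1 (tanaka_ito alpha) alpha).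

Definition matching_interval M N J :=
  [/\ (0 < M)%N, (0 < N)%N, open_subinterval J, matching_on M N J &
      forall J', open_subinterval J' -> matching_on M N J' ->
                 J `<=` J' -> J' = J].

Definition matching_set : set R :=
  [set alpha | exists M N J, matching_interval M N J /\ J alpha].

Definition bifurcation_set : set R := `[0, 1] `\` matching_set.

End tanaka_ito.

Arguments matching_set : clear implicits.
Arguments bifurcation_set : clear implicits.

(* Main.v *)
Require Import Defs.
From HB Require Import structures.
From mathcomp Require Import all_boot all_order all_algebra.
From mathcomp Require Import all_classical all_reals all_analysis.
From mathcomp Require Import ring lra zify.

(* If, for some M and N, T^M(alpha - 1) = z and T^N(alpha) = -z, where z > 0 is
   a continued fraction with partial quotients larger than 1/alpha and
   1/(1 - alpha), then T shifts both expansions without changing the signs, so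
   the two orbits never meet and alpha lies in the bifurcation set.

   For r = p/q in (0,1) both orbits reach 0, the denominators decreasing along
   them, and near r the vanishing iterates are X = (q alpha - p)/(c alpha + d)
   and Y = (q alpha - p)/(c' alpha + d') with c p + d q and c' p + d' q equal to
   1 or -1. If these signs agree, 1/X - 1/Y is an integer and matching occurs
   around r. Otherwise 1/X + 1/Y is an integer, and prescribing 1/X = D + z
   makes alpha a Moebius function of z, so that the bifurcation set contains,
   arbitrarily close to r, a bilipschitz image of the set of continued fractions
   with large partial quotients, together with the rational image of z = 0. The
   endpoints 0 and 1 always belong to the bifurcation set and behave like the
   second case.

   The set of continued fractions with partial quotients in {a, .., a + n - 1}
   has dimension greater than 1/2 for large n, because its branches contract by
   at most (d + 1)^-2 and the harmonic series diverges. *)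

Import Order.TTheory GRing.Theory Num.Theory.
Import numFieldNormedType.Exports.

Local Open Scope classical_set_scope.
Local Open Scope ring_scope.

(** * Lower bounds for the Hausdorff dimension *)

Section WordDescent.
Context {R : realType} (n : nat) (c : 'I_n -> R) (s C : R).
Context (F : (nat -> 'I_n) -> R).
Hypothesis c_gt0 : forall i, 0 < c i.
Hypothesis c_le : forall i, c i <= 2^-1.
Hypothesis s_gt0 : 0 < s.
Hypothesis C_gt0 : 0 < C.
Hypothesis sum_c : 1 <= \sum_i c i `^ s.
Hypothesis F_sep : forall (u v : nat -> 'I_n) k,
  (forall i, (i < k)%N -> u i = v i) -> u k != v k ->
  C * \prod_(i < k) c (u i) <= `|F u - F v|.

(* An infinite word is built letter by letter so that the sets meeting F of the
   current cylinder v have total weight at most sigma * c_v^s: by separation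
   each of them meets only one child cylinder, and sum_c lets one average over
   the children. A set containing the limit would have weight at most
   sigma * c_v^s for all v, hence 0. *)
Lemma word_avoiding_cover (U : nat -> set R) (w : nat -> R) (sigma : R) :
  (forall k, 0 < w k) ->
  (forall k x y, U k x -> U k y -> `|x - y| `^ s <= w k) ->
  (forall m, \sum_(k < m) w k <= sigma) -> sigma < C `^ s ->
  exists u, forall k, ~ U k (F u).
Proof.
move=> w_gt0 Uw sumw sigmaC.
pose cyl (v : nat -> 'I_n) j : set R :=
  [set F u | u in [set u | forall i, (i < j)%N -> u i = v i]].
pose a v j k : R := if `[< (U k `&` cyl v j) !=set0 >] then w k else 0.
pose cw (v : nat -> 'I_n) j : R := \prod_(i < j) c (v i).
pose ext (v : nat -> 'I_n) j (x : 'I_n) := fun i => if i == j then x else v i.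
pose good v j := forall m, \sum_(k < m) a v j k <= sigma * cw v j `^ s.
have cw_gt0 v j : 0 < cw v j by apply: prodr_gt0 => i _.
have a_ge0 v j k : 0 <= a v j k by rewrite /a; case: ifP => // _; exact: ltW.
have cw_ext v j x : cw (ext v j x) j.+1 = cw v j * c x.
  rewrite /cw big_ord_recr /= /ext eqxx; congr (_ * _).
  by apply: eq_bigr => i _; rewrite ltn_eqF.
have good_step v j : good v j -> exists x, good (ext v j x) j.+1.
  move=> gv; apply: contrapT => /forallNP noext.
  have {}noext x : exists m, sigma * cw (ext v j x) j.+1 `^ s <
      \sum_(k < m) a (ext v j x) j.+1 k.
    have /existsNP[m /negP] := noext x.
    by rewrite -ltNge => ?; exists m.
  have [m hm] := choice noext.
  (* A word has finitely many children, so one truncation works for all of them. *)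
  pose mm := (\max_x m x)%N.
  have mono v' j' p q : (p <= q)%N ->
      \sum_(k < p) a v' j' k <= \sum_(k < q) a v' j' k.
    move=> pq; rewrite -(subnK pq) addnC big_split_ord /= lerDl.
    by apply: sumr_ge0.
  have h1 : \sum_x \sum_(k < mm) a (ext v j x) j.+1 k <=
            \sum_(k < mm) a v j k.
    rewrite exchange_big /=; apply: ler_sum => k _.
    have [|Nex] := pselect (exists x, (U k `&` cyl (ext v j x) j.+1) !=set0);
      last first.
      rewrite big1 // => x _; rewrite /a; case: asboolP => // H.
      by exfalso; apply: Nex; exists x.
    move=> [x [y [Uy [u ux Fu]]]].
    rewrite (bigD1 x) //= big1 ?addr0.
      have ak : a v j k = w k.
        rewrite /a asboolT //; exists y; split => //; exists u => // i ij.
        by rewrite ux ?ltnS ?(ltnW ij)// /ext ltn_eqF.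
      by rewrite ak /a; case: ifP => // _; exact: ltW.
    move=> x' x'x; rewrite /a asboolF // => -[y' [Uy' [u' ux' Fu']]].
    have uj : u j = x by rewrite ux // /ext eqxx.
    have uj' : u' j = x' by rewrite ux' // /ext eqxx.
    have eqv i : (i < j)%N -> u i = v i.
      by move=> ij; rewrite ux ?ltnS ?(ltnW ij)// /ext ltn_eqF.
    have eqv' i : (i < j)%N -> u' i = v i.
      by move=> ij; rewrite ux' ?ltnS ?(ltnW ij)// /ext ltn_eqF.
    have := F_sep u u' j (fun i ij => etrans (eqv i ij) (esym (eqv' i ij))).
    rewrite uj uj' eq_sym x'x => /(_ isT).
    rewrite Fu Fu'; under eq_bigr => i _ do rewrite eqv //.
    rewrite -/(cw v j) => sep.
    have := Uw _ _ _ Uy Uy'; apply/negP; rewrite -ltNge.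
    (* As [U k] meets the cylinder of [v], its full weight is one of the terms that [good]
       bounds. *)
    have wk : w k <= sigma * cw v j `^ s.
      apply: le_trans (gv k.+1); rewrite big_ord_recr /=.
      rewrite {2}/a asboolT ?lerDr ?sumr_ge0//.
      by exists y; split => //; exists u.
    apply: (le_lt_trans wk); apply: (@lt_le_trans _ _ ((C * cw v j) `^ s)).
      by rewrite powRM ?ltW// ltr_pM2r// powR_gt0.
    apply: ge0_ler_powR => //; rewrite ?nnegrE ?(ltW s_gt0)//.
    by rewrite mulr_ge0 ?ltW.
  have h2 : sigma * cw v j `^ s < \sum_x \sum_(k < mm) a (ext v j x) j.+1 k.
    apply: (@le_lt_trans _ _ (\sum_x sigma * cw (ext v j x) j.+1 `^ s)).
      under eq_bigr => x _ do rewrite cw_ext powRM ?ltW// mulrA.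
      rewrite -big_distrr /= ler_peMr// mulr_ge0 ?powR_ge0//.
      by have := sumw 0%N; rewrite big_ord0.
    have [x0 _] : exists x : 'I_n, true.
      case: (pickP (fun _ : 'I_n => true)) => [x _|h]; first by exists x.
      by have := sum_c; rewrite (big_pred0 _ _ _ _ h) ler10.
    apply: ltr_sum => [|x _]; first by apply/hasP; exists x0;
      rewrite ?mem_index_enum.
    apply: lt_le_trans (hm x) _; apply: mono.
    exact: (leq_bigmax x).
  by have := lt_le_trans h2 (le_trans h1 (gv mm)); rewrite ltxx.
have [i0 _] : exists x : 'I_n, true.
  case: (pickP (fun _ : 'I_n => true)) => [x _|h]; first by exists x.
  by have := sum_c; rewrite (big_pred0 _ _ _ _ h) ler10.
(* Goodness is put under the existential so that [choice] yields a total function on pairs; [i0] is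
   a dummy letter. *)
have ext_good (p : (nat -> 'I_n) * nat) :
    exists x, good p.1 p.2 -> good (ext p.1 p.2 x) p.2.+1.
  case: p => v j; have [/good_step[x gx]|ng] := pselect (good v j).
    by exists x.
  by exists i0.
have [nxt nxtP] := choice ext_good.
(* [V j] carries the first [j] chosen letters, padded with [i0]; the infinite word [u] reads off the
   letter added at each stage. *)
pose fix V (j : nat) : nat -> 'I_n :=
  if j is j'.+1 then ext (V j') j' (nxt (V j', j')) else fun=> i0.
have goodV j : good (V j) j.
  elim: j => [|j IH]; last exact: (nxtP (V j, j)).
  move=> m; rewrite /cw big_ord0 powR1 mulr1.
  apply: le_trans (sumw m); apply: ler_sum => k _.
  by rewrite /a; case: ifP => // _; exact: ltW.
pose u j := nxt (V j, j).
have Vu j i : (i < j)%N -> V j i = u i.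
  elim: j => // j IH; rewrite ltnS leq_eqVlt /= /ext => /orP[/eqP ->|ij].
    by rewrite eqxx.
  by rewrite ltn_eqF // IH.
exists u => k Uk.
have small j : w k <= sigma * cw (V j) j `^ s.
  apply: le_trans (goodV j k.+1); rewrite big_ord_recr /=.
  rewrite {2}/a asboolT ?lerDr ?sumr_ge0//.
  by exists (F u); split => //; exists u => // i /Vu ->.
have cwle j : cw (V j) j <= 2^-1 ^+ j.
  rewrite /cw -[j in 2^-1 ^+ j]card_ord -prodr_const.
  by apply: ler_prod => i _; rewrite ltW //=.
have sigma0 : 0 <= sigma by have := sumw 0%N; rewrite big_ord0.
have powle j : w k <= sigma * (2^-1 `^ s) ^+ j.
  apply: le_trans (small j) _; apply: ler_wpM2l => //.
  rewrite -powR_mulrn ?powR_ge0// -powRrM mulrC powRrM powR_mulrn ?invr_ge0//.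
  apply: ge0_ler_powR; rewrite ?nnegrE ?(ltW s_gt0) ?(ltW (cw_gt0 _ _))//.
have q1 : `|(2^-1 : R) `^ s| < 1.
  rewrite ger0_norm ?powR_ge0//.
  have := @gt0_ltr_powR R _ s_gt0 2^-1 1; rewrite powR1; apply.
  - by rewrite nnegrE invr_ge0.
  - by rewrite nnegrE.
  - by rewrite invf_lt1 ?ltr1n.
have /cvgrPdist_lt/(_ (w k) (w_gt0 k)) :
    (fun j => sigma * (2^-1 `^ s) ^+ j) @ \oo --> (0 : R).
  by rewrite -[X in _ --> X](mulr0 sigma); apply: cvgMr; exact: cvg_expr.
case=> N _ /(_ N (leqnn N)) /=; rewrite sub0r normrN.
by move/(le_lt_trans (ler_norm _)); rewrite ltNge powle.
Qed.


(** If the measure vanished for some exponent [t < s], a cover with small sum would, suitably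
    weighted, miss a point of the range of [F] by [word_avoiding_cover]. *)
Lemma le_hausdorff_dim (A : set R) : range F `<=` A ->
  (s%:E <= hausdorff_dim A)%E.
Proof.
move=> FA; apply: le_ereal_inf_tmp => _ [t [t0 At] <-].
rewrite lee_fin leNgt; apply/negP => ts.
(* The weights will add up to at most [2 * tau], which has to stay below the s-th power of [C]. *)
pose tau : R := C `^ s / 3%:R.
have tau_gt0 : 0 < tau by rewrite divr_gt0 ?powR_gt0.
(* With diameters at most 1, powers with exponent [s] are bounded by powers with the smaller
   exponent [t]. *)
have : (hausdorff_premeasure t 1 A < tau%:E)%E.
  apply: (@le_lt_trans _ _ (hausdorff_measure t A)); last by rewrite At lte_fin.
  by apply: ereal_sup_ubound; exists 1 => //=.
move=> /ereal_inf_lt[_ [U [AU U1] <-] sumU].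
have diamP k x y : U k x -> U k y -> (`|x - y|%:E <= diameter (U k))%E.
  by move=> Ux Uy; apply: ereal_sup_ubound; right; exists (x, y).
have diam_ge0 k : (0 <= diameter (U k))%E.
  by apply: ereal_sup_ubound; left.
have diam_fin k : diameter (U k) = (fine (diameter (U k)))%:E.
  rewrite fineK // ge0_fin_numE //; apply: le_lt_trans (U1 k) _.
  exact: ltry.
pose h k : R := if U k != set0 then fine (diameter (U k)) `^ t else 0.
have h_ge0 k : 0 <= h k by rewrite /h; case: ifP => // _; exact: powR_ge0.
(* The geometric term makes the weight positive even when [h k] vanishes, and costs at most [tau] in
   total. *)
pose w k : R := h k + tau / 2 ^+ k.+1.
have [||m||u Fu] := word_avoiding_cover U w (tau + tau).
- by move=> k; rewrite ltr_wpDl // divr_gt0 // exprn_gt0.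
- move=> k x y Ux Uy.
  have Uk0 : U k != set0 by apply/set0P; exists x.
  have le1 : `|x - y| <= 1.
    by rewrite -lee_fin; apply: le_trans (U1 k); exact: diamP.
  have led : `|x - y| <= fine (diameter (U k)).
    by rewrite -lee_fin -diam_fin; exact: diamP.
  have hw : fine (diameter (U k)) `^ t <= w k.
    by rewrite /w /h Uk0 lerDl divr_ge0 ?exprn_ge0 // ltW.
  apply: le_trans hw; have [->|xy] := eqVneq x y.
    by rewrite subrr normr0 powR0 ?gt_eqF // powR_ge0.
  apply: (@le_trans _ _ (`|x - y| `^ t)).
    by apply: ger_powR (ltW ts); rewrite normr_gt0 subr_eq0 xy.
  apply: ge0_ler_powR; rewrite ?nnegrE //.
  by apply: le_trans led.
- rewrite big_split /=; apply: lerD.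
    rewrite -lee_fin; apply: le_trans (ltW sumU).
    apply: le_trans (nneseries_lim_ge m _); last first.
      by move=> k _ _; exact: poweR_ge0.
    rewrite -sumEFin big_mkord [leRHS]big_mkcond /=; apply: lee_sum => k _.
    rewrite /h; case: ifP => _ //.
    by rewrite [in leRHS]diam_fin poweR_EFin.
  rewrite -big_distrr /= ler_piMr ?(ltW tau_gt0) //.
  suff -> : \sum_(i < m) (2 ^+ i.+1)^-1 = 1 - (2 ^+ m)^-1 :> R.
    by rewrite lerBlDr lerDl invr_ge0 exprn_ge0.
  elim: m => [|m IH]; first by rewrite big_ord0 expr0 invr1 subrr.
  rewrite big_ord_recr /= IH exprS invfM.
  by move: ((2 ^+ m)^-1) => x; lra.
- rewrite /tau; have : 0 < C `^ s by rewrite powR_gt0.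
  by lra.
have [k _ Uk] := AU (F u) (FA _ (imageT F u)).
exact: Fu Uk.
Qed.

End WordDescent.

(** After the first [n] terms, the next [a + n + 1] terms are each at least [1 / (2 (a + n + 1))],
    so they add at least 1/2; four such blocks suffice. *)
Lemma harmonic_block (R : realType) (a : nat) : exists n : nat,
  2 <= \sum_(i < n) ((a + i).+1%:R : R)^-1.
Proof.
suff [n hn] : exists n, 4%:R / 2 <= \sum_(i < n) ((a + i).+1%:R : R)^-1.
  by exists n; lra.
elim: 4%N => [|k [n IH]]; first by exists 0%N; rewrite mul0r big_ord0.
exists (n + (a + n).+1)%N; rewrite big_split_ord /= -natr1 mulrDl.
apply: lerD => //.
have -> : 1 / 2 = \sum_(i < (a + n).+1) ((2 * (a + n).+1)%:R : R)^-1.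
  rewrite sumr_const card_ord -[RHS]mulr_natr natrM.
  have : (a + n).+1%:R != 0 :> R by rewrite pnatr_eq0.
  by move: (_.+1%:R) => N N0; field.
apply: ler_sum => i _; rewrite lef_pV2 ?posrE ?ltr0n // ler_nat.
by have := ltn_ord i; lia.
Qed.

(* 2s = 1 + 1/(a+n) costs at most a factor 2 since N^(1/N) <= 2. *)
Lemma digit_exponent (R : realType) (a : nat) : exists (n : nat) (s : R),
  2^-1 < s /\ 1 <= \sum_(i < n) (((a + i).+1%:R ^+ 2)^-1) `^ s.
Proof.
have [n hn] := harmonic_block R a.
have n0 : (0 < n)%N by case: n hn => //; rewrite big_ord0; lra.
pose N : nat := (a + n)%N; have N0 : (0 < N)%N by rewrite /N; lia.
exists n, (2^-1 * (1 + N%:R^-1)); split.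
  by rewrite mulrDr mulr1 ltrDl mulr_gt0 ?invr_gt0 ?ltr0n.
apply: (@le_trans _ _ (\sum_(i < n) (((a + i).+1%:R : R)^-1) * 2^-1));
  last first.
  apply: ler_sum => i _.
  have x0 : 0 < ((a + i).+1%:R : R) by rewrite ltr0n.
  rewrite -exprVn -powR_mulrn ?invr_ge0 ?(ltW x0)// -powRrM mulrA divff //
    mul1r.
  rewrite powRD; last by rewrite invr_eq0 pnatr_eq0 implybT.
  rewrite powRr1 ?invr_ge0 ?(ltW x0)//.
  apply: ler_wpM2l; first by rewrite invr_ge0 ltW.
  have := @ge0_ler_powR R N%:R^-1 _ (2^-1 ^+ N) ((a + i).+1%:R^-1).
  rewrite -powR_mulrn ?invr_ge0// -powRrM divff ?pnatr_eq0 -?lt0n//.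
  rewrite powRr1 ?invr_ge0//; apply; rewrite ?nnegrE ?powR_ge0 ?invr_ge0 //.
  rewrite powR_mulrn ?invr_ge0// exprVn lef_pV2 ?posrE ?exprn_gt0 //.
  rewrite -natrX ler_nat; apply: (@leq_trans N); last exact/ltnW/ltn_expl.
  by rewrite /N ltn_add2l.
by rewrite -big_distrl /=; lra.
Qed.

(** * Continued fractions *)

Section ContinuedFractions.
Context {R : realType}.
Implicit Types (u v : nat -> nat) (x y : R).

Definition tail (j : nat) u : nat -> nat := fun i => u (j + i)%N.

(** The finite continued fraction [0; u_0, ..., u_(k-1)]. *)
Fixpoint convergent (k : nat) u : R :=
  if k is k'.+1 then ((u 0%N)%:R + convergent k' (tail 1 u))^-1 else 0.

Definition cfrac u : R := limn (convergent ^~ u).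

(** The bound 2 makes every branch [x -> 1 / (d + x)] contract by 1/4 on nonnegative reals and keeps
    all values at most 1/2. *)
Definition digits_ge2 u := forall i, (2 <= u i)%N.

Lemma digits_ge2_tail j {u} : digits_ge2 u -> digits_ge2 (tail j u).
Proof. by move=> u2 i; exact: u2. Qed.

Lemma digit_ge2 u i : digits_ge2 u -> 2 <= (u i)%:R :> R.
Proof. by move=> u2; rewrite ler_nat. Qed.

Lemma convergent_ge0 k u : 0 <= convergent k u.
Proof.
elim: k u => //= k IH u.
by rewrite invr_ge0 addr_ge0.
Qed.

Lemma invD_dist (d x y : R) : 0 < d -> 0 <= x -> 0 <= y ->
  `|(d + x)^-1 - (d + y)^-1| = `|x - y| / ((d + x) * (d + y)).
Proof.
move=> d0 x0 y0.
have dx : 0 < d + x by lra.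
have dy : 0 < d + y by lra.
have -> : (d + x)^-1 - (d + y)^-1 = - ((x - y) / ((d + x) * (d + y))).
  by field; rewrite !gt_eqF.
by rewrite normrN normrM normfV (gtr0_norm (mulr_gt0 dx dy)).
Qed.

Lemma convergent_step k u : digits_ge2 u ->
  `|convergent k.+1 u - convergent k u| <= 4^-1 ^+ k.
Proof.
elim: k u => [|k IH] u u2.
  rewrite /= subr0 addr0 expr0 ger0_norm ?invr_ge0//.
  by rewrite invf_le1; have := digit_ge2 u 0 u2; lra.
have d2 := digit_ge2 u 0 u2.
have x0 := convergent_ge0 k.+1 (tail 1 u).
have y0 := convergent_ge0 k (tail 1 u).
have := IH _ (digits_ge2_tail 1 u2).
rewrite (_ : convergent k.+2 u =
  ((u 0%N)%:R + convergent k.+1 (tail 1 u))^-1) //.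
rewrite (_ : convergent k.+1 u = ((u 0%N)%:R + convergent k (tail 1 u))^-1) //.
move: (convergent _ _) (convergent _ _) ((u 0%N)%:R) x0 y0 d2 =>
  x y d x0 y0 d2 xy.
rewrite invD_dist //; last by lra.
rewrite exprSr; apply: ler_pM => //; first by rewrite invr_ge0 mulr_ge0; lra.
by rewrite lef_pV2 ?posrE ?mulr_gt0 //; nra.
Qed.

Lemma is_cvg_convergent u : digits_ge2 u -> cvgn (convergent ^~ u).
Proof.
move=> u2; set f := convergent ^~ u.
suff : cvgn (series (telescope f)).
  move=> h; rewrite (_ : f = (fun=> f 0%N) \+ series (telescope f)).
    by apply: is_cvgD; [exact: is_cvg_cst | exact: h].
  by apply/funext => k; rewrite /= -eq_sum_telescope.
apply: normed_cvg.
apply: (@series_le_cvg _ _ (geometric 1 4^-1)) => [n|n|n|].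
- exact: normr_ge0.
- by rewrite /geometric /= mul1r exprn_ge0 ?invr_ge0.
- by rewrite /geometric /= mul1r; exact: convergent_step.
apply: is_cvg_geometric_series.
by rewrite ger0_norm ?invr_ge0// invf_lt1 ?ltr1n.
Qed.

Lemma cfrac_ge0 u : digits_ge2 u -> 0 <= cfrac u.
Proof.
move=> u2; apply: limr_ge; first exact: is_cvg_convergent.
by near=> k; exact: convergent_ge0.
Unshelve. all: by end_near. Qed.

Lemma cfracE u : digits_ge2 u -> cfrac u = ((u 0%N)%:R + cfrac (tail 1 u))^-1.
Proof.
move=> u2; have cu := is_cvg_convergent _ u2.
have ct := is_cvg_convergent _ (digits_ge2_tail 1 u2).
have t0 := cfrac_ge0 _ (digits_ge2_tail 1 u2).
have d2 := digit_ge2 u 0 u2.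
have h1 : (fun k => convergent k.+1 u) @ \oo --> cfrac u.
  by move: cu; rewrite -(cvg_shiftS (convergent ^~ u)).
have h2 : (fun k => convergent k.+1 u) @ \oo -->
    ((u 0%N)%:R + cfrac (tail 1 u))^-1.
  apply: cvgV; first by rewrite gt_eqF //; lra.
  by apply: cvgD; [exact: cvg_cst | exact: ct].
by rewrite -(cvg_lim _ h1) // -(cvg_lim _ h2).
Qed.

Lemma cfrac_gt0 u : digits_ge2 u -> 0 < cfrac u.
Proof.
move=> u2; rewrite cfracE // invr_gt0.
have := cfrac_ge0 _ (digits_ge2_tail 1 u2); have := digit_ge2 u 0 u2; lra.
Qed.

Lemma cfrac_le u : digits_ge2 u -> cfrac u <= (u 0%N)%:R^-1.
Proof.
move=> u2; rewrite cfracE //.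
have t0 := cfrac_ge0 _ (digits_ge2_tail 1 u2).
have d2 := digit_ge2 u 0 u2.
by rewrite lef_pV2 ?posrE; lra.
Qed.

Lemma cfrac_le_half u : digits_ge2 u -> cfrac u <= 2^-1.
Proof.
move=> u2; apply: le_trans (cfrac_le _ u2) _.
by rewrite lef_pV2 ?posrE //; have := digit_ge2 u 0 u2; lra.
Qed.

(** A common leading digit [d] shrinks distances by a factor no smaller than [(d + 1)^-2], as tails
    are at most 1. At the first differing digit the two denominators differ by at least 1/2, because
    tails are at most 1/2, and neither exceeds [L]. *)
Lemma cfrac_sep (L : nat) u v k :
  digits_ge2 u -> digits_ge2 v ->
  (forall i, u i < L)%N -> (forall i, v i < L)%N ->
  (forall i, (i < k)%N -> u i = v i) -> u k != v k ->
  (2 * L%:R ^+ 2)^-1 * \prod_(i < k) ((u i).+1%:R ^+ 2)^-1 <=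
    `|cfrac u - cfrac v|.
Proof.
elim: k u v => [|k IH] u v u2 v2 uL vL uv uvk;
  rewrite (cfracE u) // (cfracE v) //;
  have x0 := cfrac_ge0 _ (digits_ge2_tail 1 u2);
  have y0 := cfrac_ge0 _ (digits_ge2_tail 1 v2);
  have x1 := cfrac_le_half _ (digits_ge2_tail 1 u2);
  have y1 := cfrac_le_half _ (digits_ge2_tail 1 v2);
  have d2 := digit_ge2 u 0 u2; have e2 := digit_ge2 v 0 v2.
  rewrite big_ord0 mulr1.
  have dL : (u 0%N)%:R + 1 <= L%:R :> R by rewrite natr1 ler_nat.
  have eL : (v 0%N)%:R + 1 <= L%:R :> R by rewrite natr1 ler_nat.
  have de : 1 <= `|(u 0%N)%:R - (v 0%N)%:R : R|.
    move: uvk; rewrite neq_ltn => /orP[] h.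
      by rewrite distrC ler_normr lerBrDl natr1 ler_nat h.
    by rewrite ler_normr lerBrDl natr1 ler_nat h.
  move: (cfrac (tail 1 u)) (cfrac (tail 1 v)) ((u 0%N)%:R) ((v 0%N)%:R) (L%:R)
    x0 y0 x1 y1 d2 e2 dL eL de.
  move=> x y d e l x0 y0 x1 y1 d2 e2 dL eL de.
  have -> : (d + x)^-1 - (e + y)^-1 = (e + y - (d + x)) / ((d + x) * (e + y)).
    by field; rewrite !gt_eqF //; lra.
  rewrite normrM normfV (@gtr0_norm _ (_ * _)); last by rewrite mulr_gt0 //;
    lra.
  rewrite invfM; apply: ler_pM; rewrite ?invr_ge0 ?exprn_ge0 //; first by lra.
    move: de; rewrite !ler_normr => /orP[] h; apply/orP; lra.
  rewrite lef_pV2 ?posrE ?mulr_gt0 ?exprn_gt0//; first nra; lra.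
have eq0 : u 0%N = v 0%N by exact: uv.
have := IH (tail 1 u) (tail 1 v) (digits_ge2_tail 1 u2) (digits_ge2_tail 1 v2)
  (fun i => uL i.+1) (fun i => vL i.+1) (fun i ik => uv i.+1 ik) uvk.
move=> {}IH; rewrite big_ord_recl /= [leLHS]mulrCA -eq0 invD_dist //; last lra.
rewrite [leLHS]mulrC; apply: ler_pM => //.
- apply: mulr_ge0; first by rewrite invr_ge0 mulr_ge0 ?exprn_ge0.
  by apply: prodr_ge0 => i _; rewrite invr_ge0 exprn_ge0.
rewrite lef_pV2 ?posrE ?mulr_gt0 ?exprn_gt0//; try lra.
rewrite -natr1; move: (cfrac (tail 1 u)) (cfrac (tail 1 v)) ((u 0%N)%:R) x0 y0
  x1 y1 d2 => x y d; nra.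
Qed.

End ContinuedFractions.

(** * Parameters with opposite orbits *)

Section OppositeOrbits.
Context {R : realType}.
Implicit Types (alpha x y z : R) (u : nat -> nat) (M N : nat).

(** Two integer translates of [1 / x] cannot both lie in the half-open interval of length 1, so
    later computations need not evaluate any floor. *)
Lemma tanaka_itoE alpha x y (D : int) : x != 0 -> alpha - 1 <= y < alpha ->
  x^-1 = D%:~R + y -> tanaka_ito alpha x = y.
Proof.
move=> /negPf x0 /andP[y1 y2] xD; rewrite /tanaka_ito x0 xD.
rewrite (_ : Num.floor _ = D); first by rewrite addrAC subrr add0r.
by apply: floor_def; rewrite intrD; apply/andP; split; lra.
Qed.

(** The tail is at most [1 / u 1], so both it and its opposite lie strictly between [alpha - 1] and
    [alpha]. *)
Lemma tanaka_ito_cfrac alpha u : digits_ge2 u ->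
  (u 1)%:R^-1 < alpha -> (u 1)%:R^-1 < 1 - alpha ->
  tanaka_ito alpha (cfrac u) = cfrac (tail 1 u) /\
  tanaka_ito alpha (- cfrac u) = - cfrac (tail 1 u).
Proof.
move=> u2 ua ua'; have z0 := cfrac_gt0 (R := R) _ u2.
have t0 := cfrac_ge0 (R := R) _ (digits_ge2_tail 1 u2).
have t1 : cfrac (tail 1 u) <= (u 1)%:R^-1 :> R :=
  cfrac_le _ (digits_ge2_tail 1 u2).
split; [apply: (@tanaka_itoE _ _ _ (u 0%N)%:Z)|
        apply: (@tanaka_itoE _ _ _ (- (u 0%N)%:Z))].
- by rewrite gt_eqF.
- by apply/andP; split; lra.
- by rewrite cfracE // invrK.
- by rewrite oppr_eq0 gt_eqF.
- by apply/andP; split; lra.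
- by rewrite cfracE // invrN invrK opprD mulrNz.
Qed.

Lemma iter_tanaka_ito_cfrac alpha u j : digits_ge2 u ->
  (forall i, (u i)%:R^-1 < alpha) -> (forall i, (u i)%:R^-1 < 1 - alpha) ->
  iter j (tanaka_ito alpha) (cfrac u) = cfrac (tail j u) /\
  iter j (tanaka_ito alpha) (- cfrac u) = - cfrac (tail j u).
Proof.
move=> u2 ua ua'; elim: j => [|j [IH1 IH2]]; first by [].
rewrite !iterS IH1 IH2.
have -> : tail j.+1 u = tail 1 (tail j u).
  by apply/funext => i; rewrite /tail addSnnS.
by apply: tanaka_ito_cfrac; [exact: digits_ge2_tail| exact: ua| exact: ua'].
Qed.

(* From some time on one orbit stays positive and the other negative. *)
Lemma opposite_orbits_bifurcation alpha u M N : digits_ge2 u ->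
  (forall i, (u i)%:R^-1 < alpha) -> (forall i, (u i)%:R^-1 < 1 - alpha) ->
  iter M (tanaka_ito alpha) (alpha - 1) = cfrac u ->
  iter N (tanaka_ito alpha) alpha = - cfrac u ->
  bifurcation_set R alpha.
Proof.
move=> u2 ua ua' hM hN.
have pos j k : 0 < cfrac (tail j u) + cfrac (tail k u) :> R.
  by apply: addr_gt0; apply: cfrac_gt0; exact: digits_ge2_tail.
split; first by rewrite /= in_itv /=; have := ua 0%N; have := ua' 0%N;
  have : 0 <= (u 0%N)%:R^-1 :> R by []; lra.
move=> [M' [N' [J [[_ _ _ [match_eq _] _] Ja]]]].
(* Another [M + N] iterations bring any matching past times [M] and [N], where one side is a
   positive tail and the other a negative one. *)
have := congr1 (iter (M + N) (tanaka_ito alpha)) (match_eq _ Ja).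
rewrite -!iterD (_ : (M + N + M' = (N + M') + M)%N); last by lia.
rewrite (_ : (M + N + N' = (M + N') + N)%N); last by lia.
rewrite iterD hM (iterD _ N) hN.
have [-> _] := iter_tanaka_ito_cfrac alpha u (N + M') u2 ua ua'.
have [_ ->] := iter_tanaka_ito_cfrac alpha u (M + N') u2 ua ua'.
by move=> h; have := pos (N + M')%N (M + N')%N; rewrite h addrC subrr ltxx.
Qed.

Definition opposite_from alpha z := exists M N,
  iter M (tanaka_ito alpha) (alpha - 1) = z /\
  iter N (tanaka_ito alpha) alpha = - z.

Lemma exists_inv_lt (e : R) : 0 < e -> exists a : nat, (2 <= a)%N /\
  forall b, (a <= b)%N -> b%:R^-1 < e.
Proof.
move=> e0; exists (Num.bound e^-1).+2; split => // b ab.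
have b0 : 0 < b%:R :> R by rewrite ltr0n; apply: leq_trans ab.
rewrite invf_plt ?posrE //; apply: lt_le_trans (archi_boundP _) _.
  by rewrite invr_ge0 ltW.
by rewrite ler_nat (leq_trans _ ab) // ltnW.
Qed.

(** * Bilipschitz families of bifurcation parameters indexed by continued fractions *)

Section OppositeBranch.
Context (r delta c : R) (g : R -> R).
Hypothesis c_gt0 : 0 < c.
Hypothesis g_expand : forall z w, 0 <= z <= 2^-1 -> 0 <= w <= 2^-1 ->
  c * `|z - w| <= `|g z - g w|.
Hypothesis g_lipschitz : forall z w, 0 <= z <= 2^-1 -> 0 <= w <= 2^-1 ->
  `|g z - g w| <= `|z - w|.
Hypothesis g0_itv : 0 < g 0 < 1.
Hypothesis g0_near : `|g 0 - r| < delta.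
Hypothesis g_opposite : forall z, 0 < z <= 2^-1 -> z < g z -> z < 1 - g z ->
  opposite_from (g z) z.

(** Large digits make [z = cfrac u] small, so [g z] stays close to [g 0] and the digit bounds of
    [opposite_orbits_bifurcation] hold uniformly. *)
Lemma branch_bifurcation : exists a : nat, (2 <= a)%N /\
  forall u, (forall i, (a <= u i)%N) -> bifurcation_set R (g (cfrac u)) /\
    `|g (cfrac u) - r| < delta.
Proof.
case/andP: g0_itv => g00 g01.
(* Half of the available room absorbs the displacement from [g 0] to [g z]; the other half still
   exceeds every [1 / u i]. *)
pose e := Num.min (Num.min (g 0) (1 - g 0)) (delta - `|g 0 - r|) / 2.
have e0 : 0 < e by rewrite divr_gt0 // !lt_min g00 subr_gt0 g01 subr_gt0.
have [a [a2 ae]] := exists_inv_lt e e0.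
exists a; split => // u ua.
have e1 : 2 * e <= g 0 by rewrite /e mulrC divfK // !ge_min lexx.
have e2 : 2 * e <= 1 - g 0 by rewrite /e mulrC divfK // !ge_min lexx orbT.
have e3 : 2 * e <= delta - `|g 0 - r|.
  by rewrite /e mulrC divfK // ge_min lexx orbT.
clearbody e.
have u2 : digits_ge2 u by move=> i; apply: leq_trans (ua i).
have z0 := cfrac_gt0 (R := R) _ u2; have zh := cfrac_le_half (R := R) _ u2.
have ze := le_lt_trans (cfrac_le (R := R) _ u2) (ae _ (ua 0%N)).
have := g_lipschitz (cfrac u) 0.
rewrite subr0 (ger0_norm (ltW z0)) (ltW z0) zh lexx invr_ge0 ler0n.
move=> /(_ isT isT) hg.
have hg' : `|g (cfrac u) - g 0| < e by exact: le_lt_trans hg ze.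
move: (hg'); rewrite ltr_distl => /andP[hg1 hg2].
split; last first.
  rewrite (_ : _ - r = (g (cfrac u) - g 0) + (g 0 - r)); last by ring.
  apply: le_lt_trans (ler_normD _ _) _; lra.
have [|||M [N [hM hN]]] := g_opposite (cfrac u); try lra.
apply: opposite_orbits_bifurcation hM hN => // i; have := ae _ (ua i); lra.
Qed.

(** At [z = 0] there is no sign to separate the orbits. Instead, matching intervals are open, while
    bifurcation parameters [g (cfrac u)] with large constant digits accumulate at [g 0]. *)
Lemma branch_origin_bifurcation : bifurcation_set R (g 0).
Proof.
split.
  by case/andP: g0_itv => h0 h1; rewrite /= in_itv /= !ltW.
move=> [M [N [J [Jmatch Jg]]]].
have [_ _ [_ oJ _ _] _ _] := Jmatch.
have /nbhs_ballP[e /= e0 eJ] := open_nbhs_nbhs (conj oJ Jg).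
have [b [b2 be]] := exists_inv_lt e e0.
have [a [a2 aE]] := branch_bifurcation.
pose u : nat -> nat := fun=> maxn a b.
have u2 : digits_ge2 u by move=> i; rewrite leq_max a2.
have [|[_ nm] _] := aE u; first by move=> i; rewrite leq_maxl.
apply: nm; exists M, N, J; split => //; apply: eJ.
rewrite /ball /= distrC.
have z0 := cfrac_gt0 (R := R) _ u2; have zh := cfrac_le_half (R := R) _ u2.
have ze := le_lt_trans (cfrac_le (R := R) _ u2) (be _ (leq_maxr _ _)).
have := g_lipschitz (cfrac u) 0.
rewrite subr0 (ger0_norm (ltW z0)) (ltW z0) zh lexx invr_ge0 ler0n.
by move=> /(_ isT isT) hg; exact: le_lt_trans hg ze.
Qed.

(** Words over the digits [a, ..., a + n - 1] are sent to parameters by [g] after [cfrac]; the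
    expansion bound multiplies the separation of [cfrac_sep], taken with [L = a + n], by [c]. *)
Lemma branch_hausdorff_dim :
  ((2^-1)%:E < hausdorff_dim (bifurcation_set R `&` `](r - delta)%R, (r +
    delta)%R[))%E.
Proof.
have [a [a2 aE]] := branch_bifurcation.
have [n [s [s_half sum_s]]] := digit_exponent R a.
apply: (@lt_le_trans _ _ s%:E); first by rewrite lte_fin.
pose dig (v : nat -> 'I_n) : nat -> nat := fun i => (a + v i)%N.
pose L := (a + n)%N.
have L0 : 0 < L%:R :> R by rewrite ltr0n /L; lia.
apply: (@le_hausdorff_dim _ n (fun i => ((a + i).+1%:R ^+ 2)^-1) s
  (c / (2 * L%:R ^+ 2)) (fun v => g (cfrac (dig v)))).
- by move=> i; rewrite invr_gt0 exprn_gt0.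
- move=> i; rewrite lef_pV2 ?posrE ?exprn_gt0 //.
  have : 3 <= (a + i).+1%:R :> R by rewrite ler_nat; lia.
  by nra.
- lra.
- by rewrite divr_gt0 // mulr_gt0 // exprn_gt0.
- exact: sum_s.
- move=> u v k uv uvk.
  have dig2 w : digits_ge2 (dig w) by move=> i; rewrite /dig; lia.
  have digL w i : (dig w i < L)%N by rewrite ltn_add2l.
  have h := cfrac_sep (R := R) L (dig u) (dig v) k (dig2 u) (dig2 v) (digL u)
    (digL v).
  have {}h := h (fun i ik => congr1 (fun j : 'I_n => (a + j)%N) (uv i ik)).
  apply: le_trans (g_expand _ _ _ _); last 2 first.
  - by rewrite cfrac_ge0 ?cfrac_le_half.
  - by rewrite cfrac_ge0 ?cfrac_le_half.
  rewrite -mulrA; apply: ler_wpM2l; first exact: ltW.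
  by apply: h; rewrite /dig eqn_add2l.
move=> _ [v _ <-].
have [|Ev near] := aE (dig v); first by move=> i; rewrite leq_addr.
split => //=; rewrite in_itv /=; move: near; rewrite ltr_distl; lra.
Qed.

End OppositeBranch.

End OppositeOrbits.

(** * Moebius families of parameters near 0, near 1 and near interior rationals *)

Section Branches.
Context {R : realType}.
Implicit Types (alpha x y z r : R) (M N : nat).

(** Membership of [r] is not demanded, so the property at 0 also serves to produce a first rational
    bifurcation parameter. *)
Definition bifurcation_near r := forall delta : R, 0 < delta ->
  (exists r', [/\ (bifurcation_set R `&` @rational R) r', r' != r &
                  `|r' - r| < delta]) /\
  ((2^-1)%:E <
    hausdorff_dim (bifurcation_set R `&` `](r - delta)%R, (r + delta)%R[))%E.

Lemma rational_int_div (m n : int) : rational (m%:~R / n%:~R : R).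
Proof. by exists (m%:~R / n%:~R) => //; rewrite fmorph_div !rmorph_int. Qed.

(** The difference of the two values is, up to sign, [z - w] times the determinant over the product
    of the denominators. *)
Lemma mobius_dist (p q p' q' K z w : R) : `|p * q' - q * p'| = 1 ->
  1 <= `|p' + q' * z| <= K -> 1 <= `|p' + q' * w| <= K ->
  (K ^+ 2)^-1 * `|z - w| <=
    `|(p + q * z) / (p' + q' * z) - (p + q * w) / (p' + q' * w)| <= `|z - w|.
Proof.
move=> det /andP[z1 zK] /andP[w1 wK].
have z0 : p' + q' * z != 0 by rewrite -normr_gt0; lra.
have w0 : p' + q' * w != 0 by rewrite -normr_gt0; lra.
have -> : (p + q * z) / (p' + q' * z) - (p + q * w) / (p' + q' * w) =
    - (p * q' - q * p') * (z - w) / ((p' + q' * z) * (p' + q' * w)).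
  by field; rewrite z0 w0.
rewrite !normrM normrN det mul1r normfV normrM.
move: z1 zK w1 wK; move: (`|p' + _|) (`|p' + _|) (normr_ge0 (z - w)).
move=> a b; move: (`|z - w|) => t t0 z1 zK w1 wK.
have ab1 : 1 <= a * b by nra.
have abK : a * b <= K ^+ 2 by nra.
rewrite [leLHS]mulrC ler_wpM2l //=; first by rewrite ler_piMr // invf_le1; lra.
by rewrite lef_pV2 ?posrE //; lra.
Qed.

(** Unimodularity supplies the bilipschitz bounds of a branch, and integrality makes [g 0] a
    rational bifurcation parameter distinct from [r]. *)
Lemma branch_mobius (r : R) (p q p' q' : int) :
  `|p * q' - q * p'| = 1 ->
  let g z : R := (p%:~R + q%:~R * z) / (p'%:~R + q'%:~R * z) in
  (forall z, 0 <= z <= 2^-1 -> 1 <= p'%:~R + q'%:~R * z) ->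
  0 < g 0 < 1 -> g 0 != r ->
  (forall z, 0 < z <= 2^-1 -> z < g z -> z < 1 - g z ->
     opposite_from (g z) z) ->
  forall delta, `|g 0 - r| < delta ->
  (exists r', [/\ (bifurcation_set R `&` @rational R) r', r' != r &
                  `|r' - r| < delta]) /\
  ((2^-1)%:E <
    hausdorff_dim (bifurcation_set R `&` `](r - delta)%R, (r + delta)%R[))%E.
Proof.
move=> det g den1 g01 g0r opp delta near.
have detR : `|p%:~R * q'%:~R - q%:~R * p'%:~R| = 1 :> R.
  by rewrite -!intrM -intrB -intr_norm det.
pose K : R := `|p'%:~R| + `|q'%:~R|.
have denK z : 0 <= z <= 2^-1 -> 1 <= `|p'%:~R + q'%:~R * z| <= K.
  move=> zi; rewrite (le_trans (den1 _ zi)) ?ler_norm //=.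
  apply: le_trans (ler_normD _ _) _; rewrite lerD2l normrM ler_piMr //.
  by rewrite ger0_norm; lra.
have dist z w zi wi := mobius_dist _ _ _ _ K z w detR (denK z zi) (denK w wi).
have K0 : 0 < K.
  have z00 : 0 <= (0 : R) <= 2^-1 by lra.
  by have /andP[h1 h2] := denK _ z00; lra.
have c0 : 0 < (K ^+ 2)^-1 by rewrite invr_gt0 exprn_gt0.
have ex z w : 0 <= z <= 2^-1 -> 0 <= w <= 2^-1 ->
    (K ^+ 2)^-1 * `|z - w| <= `|g z - g w|.
  by move=> zi wi; case/andP: (dist z w zi wi).
have lip z w : 0 <= z <= 2^-1 -> 0 <= w <= 2^-1 -> `|g z - g w| <= `|z - w|.
  by move=> zi wi; case/andP: (dist z w zi wi).
split; last exact: branch_hausdorff_dim c0 ex lip g01 near opp.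
exists (g 0); split => //; split.
  exact: branch_origin_bifurcation lip g01 near opp.
by rewrite /g !mulr0 !addr0; exact: rational_int_div.
Qed.

(** For [alpha = 1 / (D - z)] one step sends [alpha] to [-z], while two steps send [alpha - 1]
    through [-1 / (D - z - 1)] to [z]. A large [D] brings [alpha] near 0. *)
Lemma bifurcation_near0 : bifurcation_near 0.
Proof.
move=> delta delta0; have [a [a2 ad]] := exists_inv_lt delta delta0.
pose D : nat := maxn a 4.
have D4 : 4 <= D%:R :> R by rewrite ler_nat leq_maxr.
have Dd : D%:R^-1 < delta by apply: ad; rewrite leq_maxl.
have gE z : (1%:~R + 0%:~R * z) / (D%:Z%:~R + (-1)%:~R * z) = (D%:R - z)^-1 :>
  R.
  by rewrite mul0r addr0 mul1r mulN1r.
apply: (branch_mobius 0 1 0 D (-1)) => //.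
- by move=> z zi; rewrite mulN1r; lra.
- rewrite gE subr0 invr_gt0 invf_lt1; lra.
- by rewrite gE subr0 invr_eq0; lra.
- move=> z; rewrite gE; set d : R := D%:R in D4 *; move=> z0 z1 z2.
  have dE : D%:Z%:~R = d by [].
  pose alpha := (d - z)^-1.
  have b0 : 0 < (d - z - 1)^-1 by rewrite invr_gt0; lra.
  have b1 : (d - z - 1)^-1 <= 2^-1 by rewrite lef_pV2 ?posrE; lra.
  have a0 : 0 < alpha by rewrite invr_gt0; lra.
  have a1 : alpha <= 3^-1 by rewrite lef_pV2 ?posrE; lra.
  rewrite -/alpha in z1 z2 *; exists 2%N, 1%N; split => /=.
    have -> : tanaka_ito alpha (alpha - 1) = - (d - z - 1)^-1.
      apply: (@tanaka_itoE _ _ _ _ (-1)); [lra|lra|].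
      by rewrite /alpha; field; lra.
    apply: (@tanaka_itoE _ _ _ _ (1 - D%:Z)); [lra|lra|].
    by rewrite invrN invrK intrB dE; lra.
  apply: (@tanaka_itoE _ _ _ _ D%:Z); [lra|lra|].
  by rewrite /alpha invrK dE.
- by rewrite gE subr0 subr0 ger0_norm // invr_ge0; lra.
Qed.

(** The mirror image of the case of 0: with [1 - alpha = 1 / (D - z)] the two endpoint orbits
    exchange roles. *)
Lemma bifurcation_near1 : bifurcation_near 1.
Proof.
move=> delta delta0; have [a [a2 ad]] := exists_inv_lt delta delta0.
pose D : nat := maxn a 4.
have D4 : 4 <= D%:R :> R by rewrite ler_nat leq_maxr.
have Dd : D%:R^-1 < delta by apply: ad; rewrite leq_maxl.
have gE z : z <= 2^-1 ->
    ((D%:Z - 1)%:~R + (-1)%:~R * z) / (D%:Z%:~R + (-1)%:~R * z) =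
    1 - (D%:R - z)^-1 :> R.
  by move=> zh; rewrite !mulN1r intrB -[D%:Z%:~R]/(D%:R : R); field; lra.
have D0 : 0 < D%:R^-1 :> R by rewrite invr_gt0; lra.
have D1 : D%:R^-1 < 1 :> R by rewrite invf_lt1; lra.
apply: (branch_mobius 1 (D%:Z - 1) (-1) D (-1)) => //.
- by rewrite (_ : _ - _ = 1) //; ring.
- by move=> z zi; rewrite mulN1r; lra.
- rewrite gE // subr0; lra.
- by rewrite gE // subr0; lra.
- move=> z zi; rewrite gE; last by lra.
  set d : R := D%:R in D4 *; move=> z1 z2.
  have dE : D%:Z%:~R = d by [].
  pose beta := (d - z)^-1.
  have b0 : 0 < (d - z - 1)^-1 by rewrite invr_gt0; lra.
  have b1 : (d - z - 1)^-1 <= 2^-1 by rewrite lef_pV2 ?posrE; lra.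
  have a0 : 0 < beta by rewrite invr_gt0; lra.
  have a1 : beta <= 3^-1 by rewrite lef_pV2 ?posrE; lra.
  rewrite -/beta in z1 z2 *; exists 1%N, 2%N; split => /=.
    apply: (@tanaka_itoE _ _ _ _ (- D%:Z)); [lra|lra|].
    by rewrite addrAC subrr add0r /beta invrN invrK intrN dE; lra.
  have -> : tanaka_ito (1 - beta) (1 - beta) = (d - z - 1)^-1.
    apply: (@tanaka_itoE _ _ _ _ 1); [lra|lra|].
    by rewrite /beta; field; lra.
  apply: (@tanaka_itoE _ _ _ _ (D%:Z - 1)); [lra|lra|].
  by rewrite invrK intrB dE; lra.
- by rewrite gE // subr0 addrAC subrr add0r normrN gtr0_norm.
Qed.

(* With X^-1 = t the parameter is (d + p t) / (q t - c). *)
Lemma bifurcation_near_opposite (p q c d k : int) (n m : nat) : 0 < q ->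
  0 < (p%:~R / q%:~R : R) < 1 -> `|c * p + d * q| = 1 ->
  (\forall alpha \near (p%:~R / q%:~R : R), alpha != p%:~R / q%:~R ->
    let X := iter n (tanaka_ito alpha) (alpha - 1) in
    let Y := iter m (tanaka_ito alpha) alpha in
    [/\ X = (q%:~R * alpha - p%:~R) / (c%:~R * alpha + d%:~R),
        Y != 0 & X^-1 + Y^-1 = k%:~R]) ->
  bifurcation_near (p%:~R / q%:~R).
Proof.
set r : R := _ / _ => q0 r01 det /nbhs_ballP[e /= e0 ball_e] delta delta0.
have [r0 r1] := andP r01.
pose e' := Num.min (Num.min r (1 - r)) (Num.min e delta).
have e'0 : 0 < e' by rewrite !lt_min r0 subr_gt0 r1 e0.
have [b [b2 be]] := exists_inv_lt e' e'0.
have {}be := be b (leqnn _).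
have [er e1r ee ed] : [/\ e' <= r, e' <= 1 - r, e' <= e & e' <= delta].
  by split; rewrite /e' !ge_min lexx ?orbT.
clearbody e'.
have qR1 : 1 <= q%:~R :> R by rewrite ler1z; lia.
have qn0 : q%:~R != 0 :> R by rewrite gt_eqF //; lra.
have qr : q%:~R * r = p%:~R by rewrite /r mulrC divfK.
have b2R : 2 <= b%:R :> R by rewrite ler_nat.
(* The term [|c|] compensates [-c] in the denominator [q (D + z) - c], which is then at least [b];
   this puts [g z] within [1 / b < e'] of [r]. *)
pose D : int := `|c| + b%:Z.
have DR : D%:~R = `|c%:~R| + b%:R :> R by rewrite /D intrD intr_norm.
have D2 : 2 <= D%:~R :> R by rewrite DR; have := normr_ge0 (c%:~R : R); lra.
clearbody D.
have denb z : 0 <= z <= 2^-1 -> b%:R <= (q * D - c)%:~R + q%:~R * z :> R.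
  move=> /andP[z0 z1]; rewrite intrB intrM DR.
  have := ler_norm (c%:~R : R); have := normr_ge0 (c%:~R : R).
  move: (`|c%:~R : R|) (c%:~R : R) (b%:R : R) (q%:~R : R) b2R qR1 =>
    nc cc bb qq ? ? ? ?.
  by nra.
have tau1 : `|c%:~R * p%:~R + d%:~R * q%:~R : R| = 1.
  by rewrite -!intrM -intrD -intr_norm det.
have tau2 : (c%:~R * p%:~R + d%:~R * q%:~R : R) ^+ 2 = 1.
  by rewrite -real_normK ?num_real // tau1 expr1n.
pose g z : R := ((d + p * D)%:~R + p%:~R * z) / ((q * D - c)%:~R + q%:~R * z).
have gE z : 0 <= z <= 2^-1 ->
    g z - r = (c%:~R * p%:~R + d%:~R * q%:~R) /
      (q%:~R * ((q * D - c)%:~R + q%:~R * z)).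
  move=> zi; have := denb z zi; rewrite /g /r !intrB !intrD !intrM => dz.
  by field; rewrite qn0 andbT gt_eqF //; lra.
have gdist z : 0 <= z <= 2^-1 -> `|g z - r| < e' /\ g z != r.
  move=> zi; have dz := denb z zi.
  have den0 : 0 < q%:~R * ((q * D - c)%:~R + q%:~R * z) :> R.
    by rewrite mulr_gt0; lra.
  rewrite -subr_eq0 -normr_gt0 gE // normrM tau1 mul1r normfV (gtr0_norm den0).
  rewrite invr_gt0 den0; split=> //; apply: le_lt_trans be.
  by rewrite lef_pV2 ?posrE //; [nra|lra].
have z00 : 0 <= (0 : R) <= 2^-1 by lra.
apply: (branch_mobius r (d + p * D) p (q * D - c) q) => //.
- rewrite (_ : _ - _ = c * p + d * q) //; ring.
- by move=> z zi; have := denb z zi; lra.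
- by have [] := gdist 0 z00; rewrite -/(g 0) ltr_distl; lra.
- by have [] := gdist 0 z00.
- move=> z zi z1 z2; rewrite -/(g z) in z1 z2 *.
  have zi' : 0 <= z <= 2^-1 by lra.
  have [gz gzr] := gdist z zi'.
  have bg : ball r e (g z) by rewrite /ball /= distrC; lra.
  have [XE Y0 XY] := ball_e _ bg gzr.
  have XV : (iter n (tanaka_ito (g z)) (g z - 1))^-1 = D%:~R + z.
    have dz := denb z zi'.
    have den0 : q%:~R * (D%:~R + z) - c%:~R != 0 :> R.
      by rewrite gt_eqF //; move: dz; rewrite intrB intrM; lra.
    have t0 : D%:~R + z != 0 :> R by rewrite gt_eqF //; lra.
    have tau0 : c%:~R * p%:~R + d%:~R * q%:~R != 0 :> R.
      by rewrite -normr_gt0 tau1.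
    have gE' : g z = (d%:~R + p%:~R * (D%:~R + z)) / (q%:~R * (D%:~R + z) -
      c%:~R).
      by rewrite /g intrD intrB !intrM; congr (_ / _); ring.
    have h1 : q%:~R * g z - p%:~R = (c%:~R * p%:~R + d%:~R * q%:~R) /
        (q%:~R * (D%:~R + z) - c%:~R) by rewrite gE'; field.
    have h2 : c%:~R * g z + d%:~R = (c%:~R * p%:~R + d%:~R * q%:~R) *
        (D%:~R + z) / (q%:~R * (D%:~R + z) - c%:~R) by rewrite gE'; field.
    by rewrite XE h1 h2; field; rewrite t0 tau0 den0.
  have X0 : iter n (tanaka_ito (g z)) (g z - 1) != 0.
    by rewrite -invr_eq0 XV gt_eqF //; lra.
  (* One more step subtracts [D] from [1 / X = D + z] and [k - D] from [1 / Y = k - D - z], leaving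
     [z] and [-z]. *)
  exists n.+1, m.+1; split; rewrite iterS.
    apply: (@tanaka_itoE _ _ _ _ D) => //; lra.
  apply: (@tanaka_itoE _ _ _ _ (k - D)) => //; first by lra.
  by move: XY; rewrite XV intrB; lra.
- by have [] := gdist 0 z00; rewrite -/(g 0); lra.
Qed.

End Branches.

(** * Orbits of rational parameters *)

Section MobiusOrbits.
Context {R : realType} (p q : int).
Hypothesis p_gt0 : 0 < p.
Hypothesis p_lt_q : p < q.
Hypothesis coprime_pq : coprimez p q.
Let r : R := p%:~R / q%:~R.

Let q_gt0 : 0 < q. Proof. by lia. Qed.
Let qR_gt0 : 0 < q%:~R :> R. Proof. by rewrite ltr0z. Qed.
Let r_gt0 : 0 < r. Proof. by rewrite divr_gt0 // ltr0z. Qed.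
Let r_lt1 : r < 1. Proof. by rewrite ltr_pdivrMr // mul1r ltr_int. Qed.

(** As [r = p / q], the value [f r] is [(a p + b q) / (c p + d q)], in lowest terms by
    unimodularity; the descent below runs on the numerator [a p + b q]. *)
Definition mobius_at (f : R -> R) (a b c d : int) :=
  `|a * d - b * c| = 1 /\
  \forall alpha \near r, c%:~R * alpha + d%:~R != 0 /\
    f alpha = (a%:~R * alpha + b%:~R) / (c%:~R * alpha + d%:~R).

Lemma affine_at_ratio (a b : int) :
  a%:~R * r + b%:~R = (a * p + b * q)%:~R / q%:~R.
Proof. by rewrite /r intrD !intrM; field; rewrite gt_eqF. Qed.

Lemma cvg_affine (a b : R) : a * alpha + b @[alpha --> r] --> a * r + b.
Proof.
apply: cvgD; last exact: cvg_cst.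
by apply: cvgM; [exact: cvg_cst | exact: cvg_id].
Qed.

(* Were T(f r) = r - 1, the denominator q of r would divide a p + b q. *)
Lemma mobius_step (f : R -> R) (a b c d : int) : mobius_at f a b c d ->
  a * p + b * q != 0 -> `|a * p + b * q| < q -> exists D : int,
  [/\ mobius_at (fun alpha => tanaka_ito alpha (f alpha))
        (c - D * a) (d - D * b) a b,
      `|(c - D * a) * p + (d - D * b) * q| < `|a * p + b * q| &
      tanaka_ito r (f r) != r - 1].
Proof.
move=> [det fE] u0 uq.
pose h alpha : R := (c%:~R * alpha + d%:~R) / (a%:~R * alpha + b%:~R) + 1 -
  alpha.
have ar0 : a%:~R * r + b%:~R != 0 :> R.
  by rewrite affine_at_ratio mulf_neq0 ?invr_eq0 ?intr_eq0 // gt_eqF.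
have [cr0 fr] := nbhs_singleton fE.
have h_cvg : h alpha @[alpha --> r] --> h r.
  apply: cvgB; last exact: cvg_id.
  apply: cvgD; last exact: cvg_cst.
  apply: cvgM; first exact: cvg_affine.
  by apply: cvgV => //; exact: cvg_affine.
have TE alpha : a%:~R * alpha + b%:~R != 0 :> R ->
    c%:~R * alpha + d%:~R != 0 :> R ->
    f alpha = (a%:~R * alpha + b%:~R) / (c%:~R * alpha + d%:~R) ->
    tanaka_ito alpha (f alpha) =
      (c%:~R * alpha + d%:~R) / (a%:~R * alpha + b%:~R) - (Num.floor (h
        alpha))%:~R.
  move=> a0 c0 ->; rewrite /tanaka_ito mulf_eq0 invr_eq0.
  by rewrite (negPf a0) (negPf c0) /= invf_div.
pose D := Num.floor (h r).
have /andP[D1 D2] := floor_itv (h r); rewrite -/D intrD in D1 D2.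
pose u : int := a * p + b * q; pose v : int := c * p + d * q.
have uR0 : u%:~R != 0 :> R by rewrite intr_eq0.
have qR0 : q%:~R != 0 :> R by rewrite gt_eqF.
have hrE : h r = v%:~R / u%:~R + 1 - r.
  rewrite /h !affine_at_ratio -/u -/v; congr (_ + _ - _).
  by field; rewrite uR0.
have hD : h r != D%:~R.
  apply/eqP; rewrite hrE /r => /(congr1 (fun x => x * u%:~R * q%:~R)).
  rewrite (_ : _ * u%:~R * q%:~R =
    v%:~R * q%:~R + u%:~R * q%:~R - p%:~R * u%:~R);
    last by field; rewrite qR0 uR0.
  rewrite -!intrM -intrD -intrB => /eqP; rewrite eqr_int => /eqP e.
  have : (q %| u * p)%Z.
    by apply/dvdzP; exists (v + u - D * u); lia.
  rewrite Gauss_dvdzl; last by rewrite coprimez_sym.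
  move=> /dvdzP[t ut]; move: u0 uq.
  rewrite -/u ut mulf_eq0 negb_or normrM (gtr0_norm q_gt0) => /andP[t0 _].
  by rewrite gtr_pMl // ltNge -gtz0_ge1 normr_gt0 t0.
have TrE := TE r ar0 cr0 fr; rewrite -/D in TrE.
have DhL : D%:~R < h r by rewrite lt_def hD.
exists D; split.
- split; first by rewrite -[RHS]det -[LHS]normrN; congr `|_|; ring.
  near=> alpha.
  have a0 : a%:~R * alpha + b%:~R != 0 :> R.
    by near: alpha; apply: (cvgr_neq0 _ (cvg_affine _ _)).
  split => //; have [c0 fa] : c%:~R * alpha + d%:~R != 0 :> R /\
    f alpha = (a%:~R * alpha + b%:~R) / (c%:~R * alpha + d%:~R) by near: alpha.
  (* The floor is constant near [r] because [h r] lies strictly between [D] and [D + 1]. *)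
  rewrite (TE _ a0 c0 fa) (_ : Num.floor _ = D).
    by rewrite !intrB !intrM; field.
  apply: floor_def; apply/andP; split.
    by apply: ltW; near: alpha; exact: (cvgr_gt _ h_cvg).
  by near: alpha; rewrite intrD; exact: (cvgr_lt _ h_cvg).
(* The new numerator is [u] times the image [v / u - D] of [f r], which lies in [[r - 1, r)] and so
   has absolute value below 1. *)
- have -> : (c - D * a) * p + (d - D * b) * q = v - D * u by rewrite /u /v;
  ring.
  rewrite -(ltr_int R) !intr_norm -/u intrB intrM.
  have -> : v%:~R - D%:~R * u%:~R = (v%:~R / u%:~R - D%:~R) * u%:~R :> R.
    by field; rewrite uR0.
  rewrite normrM gtr_pMl ?normr_gt0 // ltr_norml; move: hrE r_gt0 r_lt1; lra.
- apply/eqP => T1; move/eqP: hD; apply; move: T1; rewrite TrE /h; lra.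
Unshelve. all: by end_near. Qed.

Definition ti_orbit (f : R -> R) (k : nat) alpha :=
  iter k (tanaka_ito alpha) (f alpha).

Lemma ti_orbitS (f : R -> R) k alpha :
  ti_orbit f k.+1 alpha = tanaka_ito alpha (ti_orbit f k alpha).
Proof. by []. Qed.

Definition mobius_fun (f : R -> R) := exists a b c d, mobius_at f a b c d.

(** By [mobius_step] the numerator decreases strictly in absolute value until it vanishes; [m] is
    the fuel of the induction. *)
Lemma orbit_descent (f : R -> R) (m k : nat) (a b c d : int) :
  (absz (a * p + b * q)%R < m)%N -> `|a * p + b * q| < q ->
  mobius_at (ti_orbit f k) a b c d -> exists n,
  [/\ (k <= n)%N, forall j, (k <= j <= n)%N -> mobius_fun (ti_orbit f j),
      exists a b c d, mobius_at (ti_orbit f n) a b c d /\ a * p + b * q = 0 &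
      forall j, (k < j <= n)%N -> ti_orbit f j r != r - 1].
Proof.
elim: m k a b c d => // m IH k a b c d um uq mk.
have mobk : mobius_fun (ti_orbit f k) by exists a, b, c, d.
have [u0|u0] := eqVneq (a * p + b * q) 0.
  exists k; split => //.
  - by move=> j; rewrite -eqn_leq => /eqP <-.
  - by exists a, b, c, d.
  - by move=> j /andP[/leq_trans/[apply]]; rewrite ltnn.
have [D [mk1 ulow rk1]] := mobius_step _ _ _ _ _ mk u0 uq.
have [||n [kn mobn last_n ne_n]] := IH k.+1 _ _ _ _ _ _ mk1; [lia|lia|].
exists n; split => //; first by rewrite ltnW.
- move=> j /andP[]; rewrite leq_eqVlt => /orP[/eqP <- //|kj jn].
  by apply: mobn; rewrite kj.
- move=> j /andP[]; rewrite leq_eqVlt => /orP[/eqP <- //|kj jn].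
  by apply: ne_n; rewrite kj.
Qed.

(** Coprimality gives [(a, b) = t (q, -p)], the determinant forces [t = 1] or [t = -1], and this
    sign is moved to the denominator. *)
Lemma mobius_vanishing (f : R -> R) (a b c d : int) :
  mobius_at f a b c d -> a * p + b * q = 0 -> exists c' d' : int,
  `|c' * p + d' * q| = 1 /\
  \forall alpha \near r, c'%:~R * alpha + d'%:~R != 0 /\
    f alpha = (q%:~R * alpha - p%:~R) / (c'%:~R * alpha + d'%:~R).
Proof.
move=> [det fE] u0.
have : (q %| a * p)%Z by apply/dvdzP; exists (- b); lia.
rewrite Gauss_dvdzl; last by rewrite coprimez_sym.
move=> /dvdzP[t at_].
have bt : b = - t * p by move: u0; rewrite at_; nia.
have h : `|t| * `|c * p + d * q| = 1.
  by rewrite -normrM -[RHS]det; congr `|_|; rewrite at_ bt; ring.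
have t1 : t = 1 \/ t = -1.
  have : (absz t * absz (c * p + d * q)%R = 1)%N by lia.
  by move/eqP; rewrite muln_eq1 => /andP[/eqP t1 _]; lia.
have tR : (t%:~R : R) = 1 \/ (t%:~R : R) = -1.
  by case: t1 => ->; [left | right].
exists (t * c), (t * d); split.
  by rewrite -h -normrM; congr `|_|; ring.
apply: filterS fE => alpha [c0 ->].
rewrite at_ bt !intrM intrN.
have -> : t%:~R * c%:~R * alpha + t%:~R * d%:~R =
  t%:~R * (c%:~R * alpha + d%:~R) :> R by ring.
by case: tR => ->; rewrite ?mul1r ?mulN1r ?oppr_eq0; split=> //; field.
Qed.

Lemma orbit_to_zero (f : R -> R) (a b c d : int) : mobius_at f a b c d ->
  `|a * p + b * q| < q -> exists (n : nat) (c d : int),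
  [/\ `|c * p + d * q| = 1,
      \forall alpha \near r, c%:~R * alpha + d%:~R != 0 /\
        ti_orbit f n alpha = (q%:~R * alpha - p%:~R) / (c%:~R * alpha + d%:~R),
      forall j, (j <= n)%N -> mobius_fun (ti_orbit f j),
      ti_orbit f n r = 0 &
      forall j, (0 < j)%N -> ti_orbit f j r != r - 1].
Proof.
move=> fE uq.
have [n [_ mobn [a' [b' [c' [d' [fn u0]]]]] ne_n]] :=
  orbit_descent f _ 0 _ _ _ _ (ltnSn _) uq fE.
have [c1 [d1 [det fn1]]] := mobius_vanishing _ _ _ _ _ fn u0.
have n0 : ti_orbit f n r = 0.
  have [_ ->] := nbhs_singleton fn1.
  by rewrite /r [q%:~R * (_ / _)]mulrC divfK ?gt_eqF // subrr mul0r.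
exists n, c1, d1; split => // j j0.
have [jn|nj] := leqP j n; first by apply: ne_n; rewrite j0.
(* After time [n] the orbit of [r] rests at the fixed point 0, which differs from [r - 1]. *)
rewrite /ti_orbit -(subnK (ltnW nj)) iterD -/(ti_orbit f n r) n0.
rewrite (_ : iter _ _ _ = 0); last by elim: (j - n)%N => //= i ->;
  rewrite /tanaka_ito eqxx.
by rewrite eq_sym lt_eqF // subr_lt0.
Qed.

End MobiusOrbits.

(** * Matching *)

Section Matching.
Context {R : realType}.
Implicit Types (alpha x y r : R) (J : set R).

Lemma finite_root_set (P : {poly R}) : P != 0 -> finite_set [set x | root P x].
Proof.
move=> P0; apply: contrapT => /infinite_set_fset - /(_ (size P))[B BP cB].
have := @max_poly_roots _ P (finmap.enum_fset B) P0.
rewrite ltnNge cB finmap.fset_uniq => roots.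
by suff: false by []; apply: roots => //; apply/allP => x xB; exact: BP.
Qed.

(** The maximal interval is the union of all such intervals through [r]. The almost-everywhere
    condition survives this possibly uncountable union because countably many of the intervals
    already cover it. *)
Lemma maximal_matching_interval M N J r : (0 < M)%N -> (0 < N)%N ->
  open_subinterval J -> matching_on M N J -> J r -> matching_set R r.
Proof.
move=> M0 N0 oJ mJ Jr.
pose good J' := [/\ open_subinterval J', matching_on M N J' & J' r].
pose U := \bigcup_(J' in good) J'.
have goodJ : good J by [].
have oU : open U by apply: bigcup_open => J' [[]].
have Ur : U r by exists J.
have itvU : is_interval U.
  move=> x y [Jx gx Jxx] [Jy gy Jyy] z /andP[xz zy].
  have [zr|rz] := leP z r.
  - exists Jx => //; case: gx => -[_ _ ix _] _ Jxr.
    by apply: (ix x r) => //; rewrite xz.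
  - exists Jy => //; case: gy => -[_ _ iy _] _ Jyr.
    by apply: (iy r y) => //; rewrite (ltW rz).
have oiU : open_subinterval U.
  split=> //; first by exists r.
  by move=> x [J' [[_ _ _ sub] _ _] /sub].
have mU : matching_on M N U.
  split; first by move=> x [J' [_ [h _] _] /h].
  (* For each rational point of [U] one interval containing it is chosen; [F] collects the
     exceptional sets of the chosen intervals. *)
  pose pick (k : nat) := match unpickle k with
    | Some s => [set J' | good J' /\ J' (ratr s)] | None => set0 end.
  pose bad J' := ~` [set x | J' x -> iter M.-1 (tanaka_ito x) (x - 1) <>
     iter N.-1 (tanaka_ito x) x].
  pose F k := if pselect (pick k !=set0) is left h then bad (sval (cid h)) else
    set0.
  have negF k : lebesgue_measure.-negligible (F k).
    rewrite /F; case: pselect => [h|_]; last exact: negligible_set0.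
    case: (cid h) => J' /=; rewrite /pick; case: (unpickle k) => //= s.
    by move=> [[_ [_ ?] _] _].
  apply: negligibleS (negligible_bigcup negF) => x /not_implyP[Ux eqx].
  (* The rational is taken just beyond [x] as seen from [r], so an interval through [r] and this
     rational contains [x]. *)
  have [q Uq xq] : exists2 q : rat, U (ratr q) &
      forall J', good J' -> J' (ratr q) -> J' x.
    have /nbhs_ballP[e /= e0 eU] := open_nbhs_nbhs (conj oU Ux).
    have [rx|xr] := leP r x.
    - have [q] := @rat_in_itvoo R x (x + e) ltac:(lra).
      rewrite in_itv /= => /andP[q1 q2]; exists q.
        by apply: eU; rewrite /ball /= ltr_norml; lra.
      move=> J' [[_ _ iJ _] _ J'r] J'q; apply: (iJ r (ratr q)) => //.
      by rewrite rx ltW.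
    - have [q] := @rat_in_itvoo R (x - e) x ltac:(lra).
      rewrite in_itv /= => /andP[q1 q2]; exists q.
        by apply: eU; rewrite /ball /= ltr_norml; lra.
      move=> J' [[_ _ iJ _] _ J'r] J'q; apply: (iJ (ratr q) r) => //.
      by rewrite !ltW.
  exists (pickle q) => //; rewrite /F; case: pselect => [h|nh]; last first.
    exfalso; apply: nh; have [J' gJ' Jq] := Uq; exists J'.
    by rewrite /pick pickleK.
  case: (cid h) => J' /=; rewrite /pick pickleK => -[gJ' Jq] h'.
  by apply: (h' _); [exact: xq | exact: contrapT].
exists M, N, U; split=> //; split=> // J' oJ' mJ' UJ'.
apply/seteqP; split=> // x J'x; exists J' => //; split=> //; exact: UJ'.
Qed.

Lemma tanaka_ito_shift alpha x y (k : int) : x != 0 -> y != 0 ->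
  x^-1 = y^-1 + k%:~R -> tanaka_ito alpha x = tanaka_ito alpha y.
Proof.
move=> x0 y0 e; rewrite /tanaka_ito (negPf x0) (negPf y0) e.
rewrite (_ : _ + _ + 1 - alpha = (y^-1 + 1 - alpha) + k%:~R); last by ring.
by rewrite floorDrz ?intrKfloor ?intrD; [ring | exact: intr_int].
Qed.

Lemma tanaka_ito_lt alpha x : 0 < alpha -> tanaka_ito alpha x < alpha.
Proof.
move=> a0; rewrite /tanaka_ito; case: ifP => // _.
by have /andP[_] := floor_itv (x^-1 + 1 - alpha); rewrite intrD; lra.
Qed.

(** After clearing denominators, equality becomes the vanishing of a polynomial. It is nonzero,
    since otherwise [f] and [g] would agree near the point, so its root set is finite and null. *)
Lemma mobius_eq_ae (p q : int) (f g : R -> R) :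
  mobius_fun p q f -> mobius_fun p q g ->
  ~ (\forall alpha \near (p%:~R / q%:~R : R), f alpha = g alpha) ->
  exists2 e : R, 0 < e & \forall alpha \ae (@lebesgue_measure R),
    ball (p%:~R / q%:~R : R) e alpha -> f alpha <> g alpha.
Proof.
move=> [a [b [c [d [_ fE]]]]] [a' [b' [c' [d' [_ gE]]]]] nfg.
pose aff (s t : int) : {poly R} := s%:~R *: 'X + t%:~R%:P.
have affE s t x : (aff s t).[x] = s%:~R * x + t%:~R by rewrite /aff !hornerE.
pose P := aff a b * aff c' d' - aff a' b' * aff c d.
have PE x : P.[x] = (a%:~R * x + b%:~R) * (c'%:~R * x + d'%:~R) -
    (a'%:~R * x + b'%:~R) * (c%:~R * x + d%:~R).
  by rewrite /P hornerD hornerN !hornerM !affE.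
have fgP : \forall x \near (p%:~R / q%:~R : R), (f x == g x) = root P x.
  near=> x.
  have [c0 ->] : c%:~R * x + d%:~R != 0 /\
    f x = (a%:~R * x + b%:~R) / (c%:~R * x + d%:~R) by near: x.
  have [c'0 ->] : c'%:~R * x + d'%:~R != 0 /\
    g x = (a'%:~R * x + b'%:~R) / (c'%:~R * x + d'%:~R) by near: x.
  by rewrite /root PE eqr_div // subr_eq0.
have P0 : P != 0.
  apply/eqP => P0; apply: nfg; apply: filterS fgP => x.
  by rewrite P0 root0 => /eqP.
have /nbhs_ballP[e /= e0 eP] := fgP.
have countP : countable [set x | root P x].
  by apply: finite_set_countable; exact: finite_root_set.
have negP : (@lebesgue_measure R).-negligible [set x | root P x].
  apply/negligibleP; last exact: countable_lebesgue_measure0.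
  exact: countable_measurable.
exists e => //; apply: negligibleS negP => x /not_implyP[bx /contrapT fg].
by have := eP _ bx; rewrite fg eqxx => /esym.
Unshelve. all: by end_near. Qed.

End Matching.

(** * Matching or opposite orbits at interior rational parameters *)

Section RationalParameters.
Context {R : realType} (p q : int).
Hypothesis p_gt0 : 0 < p.
Hypothesis p_lt_q : p < q.
Hypothesis coprime_pq : coprimez p q.
Let r : R := p%:~R / q%:~R.
Let xorb k alpha : R := ti_orbit (fun x => x - 1) k alpha.
Let yorb k alpha : R := ti_orbit id k alpha.

Let q_gt0 : 0 < q. Proof. by lia. Qed.
Let qR_gt0 : 0 < q%:~R :> R. Proof. by rewrite ltr0z. Qed.
Let r_gt0 : 0 < r. Proof. by rewrite divr_gt0 // ltr0z. Qed.
Let r_lt1 : r < 1. Proof. by rewrite ltr_pdivrMr // mul1r ltr_int. Qed.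

(** Both orbits are traced back while they still agree near [r]. This stops before either index
    reaches 0: [yorb] avoids [r - 1] at [r], and images under [tanaka_ito] stay strictly below the
    parameter. *)
Lemma last_matching n m : (forall j, (0 < j)%N -> yorb j r != r - 1) ->
  (\forall alpha \near r, xorb n alpha = yorb m alpha) -> exists n' m' : nat,
  [/\ (n' < n)%N, (m' < m)%N,
      \forall alpha \near r, xorb n'.+1 alpha = yorb m'.+1 alpha &
      ~ \forall alpha \near r, xorb n' alpha = yorb m' alpha].
Proof.
move=> yr; elim: n m => [|n IH] m xy.
  have := nbhs_singleton xy; rewrite {1}/xorb /ti_orbit /= => /esym yrE.
  case: m xy yrE => [_|m _ yrE].
    by rewrite /yorb /ti_orbit /=; lra.
  by have := yr m.+1 isT; rewrite yrE eqxx.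
case: m xy => [|m] xy.
  have := nbhs_singleton xy; rewrite /yorb /ti_orbit /=.
  by have := tanaka_ito_lt r (xorb n r) r_gt0; rewrite /xorb /ti_orbit; lra.
have [xy'|xy'] := pselect (\forall alpha \near r, xorb n alpha = yorb m alpha).
  have [n' [m' [nn mm h h']]] := IH m xy'.
  by exists n', m'; split => //; rewrite ltnS ltnW.
by exists n, m.
Qed.

(** Just before the last matching, the iterates are Moebius functions not equal near [r], hence
    distinct almost everywhere on a small ball. *)
Lemma last_matching_matched n m :
  (forall j, (0 < j)%N -> yorb j r != r - 1) ->
  (forall j, (j < n)%N -> mobius_fun p q (xorb j)) ->
  (forall j, (j < m)%N -> mobius_fun p q (yorb j)) ->
  (\forall alpha \near r, xorb n alpha = yorb m alpha) -> matching_set R r.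
Proof.
move=> yr xmob ymob /(last_matching _ _ yr)[n' [m' [nn mm xy nxy]]].
have [e e0 ae_neq] := mobius_eq_ae p q _ _ (xmob _ nn) (ymob _ mm) nxy.
have /nbhs_ballP[e1 /= e10 xyE] := xy.
pose e' := Num.min (Num.min e e1) (Num.min r (1 - r)).
have e'0 : 0 < e' by rewrite !lt_min e0 e10 r_gt0 subr_gt0 r_lt1.
have [ee ee1 er er1] : [/\ e' <= e, e' <= e1, e' <= r & e' <= 1 - r].
  by split; rewrite /e' !ge_min lexx ?orbT.
clearbody e'.
apply: (@maximal_matching_interval _ n'.+1 m'.+1 (ball r e')) => //.
- split.
  + by exists r; exact: ballxx.
  + exact: ball_open.
  + move=> x y; rewrite /ball /= !ltr_distl => x1 y1 z /andP[xz zy].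
    by rewrite ltr_distl; lra.
  + by move=> x; rewrite /ball /= ltr_distl in_itv /= => ?; lra.
- split.
    by move=> x xr; apply: xyE; exact: le_ball xr.
  apply: negligibleS ae_neq => x h h'; apply: h => xr; apply: h'.
  exact: le_ball xr.
- exact: ballxx.
Qed.

Lemma int_orthogonal_coprime (a b : int) : a * p + b * q = 0 ->
  exists k, a = k * q /\ b = - (k * p).
Proof.
move=> ab; have : (q %| a * p)%Z by apply/dvdzP; exists (- b); lia.
rewrite Gauss_dvdzl; last by rewrite coprimez_sym.
move=> /dvdzP[k ak]; exists k; split => //.
by apply: (mulIf (x := q)); [lia|move: ab; rewrite ak; lia].
Qed.

Lemma bifurcation_near_interior : bifurcation_set R r -> bifurcation_near r.
Proof.
move=> [_ nmatch].
(* The numerators at [r] of the two starting points are [p - q] and [p], both smaller than [q] in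
   absolute value. *)
have mx : mobius_at p q (fun x : R => x - 1) 1 (-1) 0 1.
  split=> //; near=> x.
  by rewrite !mul0r !mul1r add0r oner_eq0 divr1.
have my : mobius_at p q (@id R) 1 0 0 1.
  split=> //; near=> x.
  by rewrite !mul0r !mul1r add0r addr0 oner_eq0 divr1.
have [|n [c [d [det xE xmob xr0 _]]]] :=
  orbit_to_zero p q p_gt0 p_lt_q coprime_pq _ _ _ _ _ mx; try lia.
have [|m [c' [d' [det' yE ymob yr0 yr]]]] :=
  orbit_to_zero p q p_gt0 p_lt_q coprime_pq _ _ _ _ _ my; try lia.
have [same|opp] : c * p + d * q = c' * p + d' * q \/
    c * p + d * q = - (c' * p + d' * q) by lia.
  exfalso; apply: nmatch.
  have [k [ck dk]] : exists k, c - c' = k * q /\ d - d' = - (k * p).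
    by apply: int_orthogonal_coprime; lia.
  apply: (@last_matching_matched n.+1 m.+1 yr xmob ymob).
  (* At [r] itself both iterates are 0, which is fixed; elsewhere their inverses differ by the
     integer [k]. *)
  near=> x; have [xr|xr] := eqVneq x r.
    by rewrite /xorb /yorb xr !ti_orbitS xr0 yr0.
  rewrite /xorb /yorb !ti_orbitS.
  have [c0 ->] : c%:~R * x + d%:~R != 0 /\ ti_orbit (fun x => x - 1) n x =
    (q%:~R * x - p%:~R) / (c%:~R * x + d%:~R) by near: x.
  have [c'0 ->] : c'%:~R * x + d'%:~R != 0 /\ ti_orbit id m x =
    (q%:~R * x - p%:~R) / (c'%:~R * x + d'%:~R) by near: x.
  have x0 : q%:~R * x - p%:~R != 0.
    apply: contra xr; rewrite subr_eq0 => /eqP qx; apply/eqP.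
    by rewrite /r -qx mulrC mulKf // gt_eqF.
  apply: (@tanaka_ito_shift _ _ _ _ k); rewrite ?mulf_neq0 ?invr_eq0 //.
  rewrite !invf_div.
  have -> : c = c' + k * q by lia.
  have -> : d = d' - k * p by lia.
  by rewrite intrD intrB !intrM; field.
have [k [ck dk]] : exists k, c + c' = k * q /\ d + d' = - (k * p).
  by apply: int_orthogonal_coprime; lia.
apply: (@bifurcation_near_opposite _ p q c d k n m) => //;
  first by rewrite r_gt0.
near=> x; move=> xr.
have [c0 xnE] : c%:~R * x + d%:~R != 0 /\ ti_orbit (fun x => x - 1) n x =
  (q%:~R * x - p%:~R) / (c%:~R * x + d%:~R) by near: x.
have [c'0 ymE] : c'%:~R * x + d'%:~R != 0 /\ ti_orbit id m x =
  (q%:~R * x - p%:~R) / (c'%:~R * x + d'%:~R) by near: x.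
have x0 : q%:~R * x - p%:~R != 0.
  apply: contra xr; rewrite subr_eq0 => /eqP qx; apply/eqP.
  by rewrite -qx mulrC mulKf // gt_eqF.
rewrite /= -/(ti_orbit (fun x => x - 1) n x) -/(ti_orbit id m x) xnE ymE.
split => //; first by rewrite mulf_neq0 ?invr_eq0.
rewrite !invf_div.
have -> : c' = - c + k * q by lia.
have -> : d' = - d - k * p by lia.
by rewrite intrD intrB !intrM !intrN; field.
Unshelve. all: by end_near. Qed.

End RationalParameters.

(** * Local structure of the bifurcation set at all of its rational points *)

Lemma bifurcation_rational_near (R : realType) (r : R) :
  (bifurcation_set R `&` @rational R) r -> bifurcation_near r.
Proof.
move=> [Er [s _ sr]]; have := Er.1; rewrite /= in_itv /= => /andP[r0 r1].
have [->|rN0] := eqVneq r 0; first exact: bifurcation_near0.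
have [->|rN1] := eqVneq r 1; first exact: bifurcation_near1.
have rE : r = (numq s)%:~R / (denq s)%:~R by rewrite -sr /ratr.
have d0 : 0 < (denq s)%:~R :> R by rewrite ltr0z denq_gt0.
have r0' : 0 < r by rewrite lt_def rN0.
have r1' : r < 1 by rewrite lt_def eq_sym rN1.
move: Er; rewrite rE; apply: bifurcation_near_interior.
- by move: r0'; rewrite rE pmulr_lgt0 ?invr_gt0 // ltr0z.
- by move: r1'; rewrite rE ltr_pdivrMr // mul1r ltr_int.
- by rewrite /coprimez; exact: coprime_num_den.
Qed.

Theorem theorem1p6 (R : realType) :
  [/\ infinite_set (bifurcation_set R `&` @rational R),
      isolated (bifurcation_set R `&` @rational R) = set0 &
      forall r delta : R, (bifurcation_set R `&` @rational R) r -> 0 < delta ->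
        ((2^-1)%:E <
         hausdorff_dim (bifurcation_set R `&` `](r - delta)%R, (r + delta)%R[))%E].
Proof.
set A := bifurcation_set R `&` @rational R.
have iso0 : isolated A = set0.
  rewrite -subset0 => r [/set_mem Ar [V /nbhs_ballP[e /= e0 eV] VA]].
  have [[r' [Ar' r'r r're]] _] := bifurcation_rational_near R r Ar e e0.
  have : (V `&` A) r' by split => //; apply: eV; rewrite /ball /= distrC.
  by rewrite VA /= => /eqP; rewrite (negPf r'r).
split => //; last first.
  by move=> r delta Ar d0; have [] := bifurcation_rational_near R r Ar delta d0.
(* A finite set has only isolated points, and the family near 0 shows that [A] is nonempty. *)
move=> finA.
have [r [Ar _ _]] := (@bifurcation_near0 R 1 ltr01).1.
suff : isolated A r by rewrite iso0.
split; first exact/mem_set.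
exists (~` (A `\ r)).
  apply: open_nbhs_nbhs; split; last by move=> [_]; apply.
  apply: closed_openC; apply: (accessible_finite_set_closed.1 _).
    exact: hausdorff_accessible (@Rhausdorff R).
  exact: sub_finite_set (@subDsetl _ A [set r]) finA.
apply/seteqP; split=> [x /= [nA Ax]|x /= ->]; last by split => // -[_]; apply.
by apply: contrapT => xr; apply: nA.
Qed.
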